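(* Let $\Gamma$ be a group acting on a set $X$. For $g\in\Gamma$ let $\mathrm{Fix}(g|X)\subseteq X$ be the fixed point set of $g$ in $X$. The following conditions are equivalent: (1) The action is an essentially free amenable action. (2) The action is non-paradoxical in the following sense: $X$ cannot be written as a union of (finitely many) subsets $X=A_1\cup A_2\cup\dots\cup A_l\cup B_1\cup B_2\cup\dots\cup B_m$ such that (a) for some group elements $g_1,h_1,g_2,h_2,\dots,g_l,h_l\in\Gamma$ the $2l$ subsets $g_1A_1,h_1A_1,g_2A_2,h_2A_2,\dots,g_lA_l,h_lA_l$ are pairwise disjoint; (b) for each $B_i$ there is an element $1\neq p_i\in\Gamma$ with $B_i=\mathrm{Fix}(p_i|X)$. (3) For any finite subset $K\subseteq\Gamma$ and any $\epsilon>0$ there exists a non-empty finite subset $F\subseteq X$ such that (a) $\frac{|gF\,\triangle\, F|}{|F|}<\epsilon$ for any $g\in K$; (b) $\frac{|\mathrm{Fix}(g|X)\cap F|}{|F|}<\epsilon$ for any $1\neq g\in K$.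
   Context: An action of $\Gamma$ on $X$ is amenable if there is a $\Gamma$-invariant finitely additive probability measure defined on all subsets of $X$. It is an essentially free amenable action if there exists a $\Gamma$-invariant finitely additive probability measure $\mu$ on (all subsets of) $X$ such that $\mu(\mathrm{Fix}(g|X))=0$ for every $1\ne g\in\Gamma$. In condition (2), $l,m\ge 0$ are allowed; $\triangle$ denotes symmetric difference. *)

(* Defs.v *)
From HB Require Import structures.
From mathcomp Require Import all_boot all_order all_algebra finmap.
From mathcomp Require Import boolp classical_sets cardinality reals.

Set Implicit Arguments.
Unset Strict Implicit.
Unset Printing Implicit Defensive.

Import Order.TTheory GRing.Theory Num.Theory.

Local Open Scope classical_set_scope.
Local Open Scope ring_scope.

(* Left action of an arbitrary group on a type; the actions of MathComp's
   fingroup library are right actions of finite groups only. *)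
Record left_action (G : groupType) (X : Type) := LeftAction {
  act :> G -> X -> X;
  act_one : forall x, act 1%g x = x;
  act_mul : forall g h x, act (g * h)%g x = act g (act h x)
}.

Definition Fix (G : groupType) (X : Type) (a : left_action G X) (g : G) :
  set X := [set x | a g x = x].

(* The contents of MathComp-Analysis live on pointed types, which would exclude
   the empty set; here X may be empty (and then carries no such measure). *)
Record finitely_additive_probability (R : realType) (X : Type)
    (mu : set X -> R) : Prop := FinitelyAdditiveProbability {
  fap_ge0 : forall A, 0 <= mu A;
  fap_additive : forall A B, A `&` B = set0 -> mu (A `|` B) = mu A + mu B;
  fap_total : mu [set: X] = 1
}.

Definition invariant_measure (R : realType) (G : groupType) (X : Type)
    (a : left_action G X) (mu : set X -> R) : Prop :=
  forall g A, mu (a g @` A) = mu A.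

Definition essentially_free_amenable (R : realType) (G : groupType) (X : Type)
    (a : left_action G X) : Prop :=
  exists mu : set X -> R,
    [/\ finitely_additive_probability mu,
        invariant_measure a mu
      & forall g : G, g <> 1%g -> mu (Fix a g) = 0].

(* The 2l translates are indexed by the disjoint union 'I_l + 'I_l, so that
   trivIset also forces g_i A_i and h_i A_i to be disjoint for each i. *)
Definition paradoxical (G : groupType) (X : Type) (a : left_action G X) :
    Prop :=
  exists (l m : nat) (A : 'I_l -> set X) (B : 'I_m -> set X),
    [/\ [set: X] = (\bigcup_i A i) `|` (\bigcup_j B j),
        exists g h : 'I_l -> G,
          trivIset [set: 'I_l + 'I_l]
            (fun k => match k with
                      | inl i => a (g i) @` A i
                      | inr i => a (h i) @` A i
                      end)
      & forall j, exists2 p : G, p <> 1%g & B j = Fix a p].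

(* fset_set is junk on infinite sets; here it is only applied to finite ones. *)
Definition free_Folner (R : realType) (G : groupType) (X : choiceType)
    (a : left_action G X) : Prop :=
  forall (K : {fset G}) (eps : R), 0 < eps ->
    exists F : {fset X},
      [/\ F != fset0,
          forall g, g \in K ->
            (#|` fset_set ((a g @` [set` F]) `+` [set` F])|)%:R
              / (#|` F|)%:R < eps
        & forall g, g \in K -> g <> 1%g ->
            (#|` fset_set (Fix a g `&` [set` F])|)%:R / (#|` F|)%:R < eps].

(* Main.v *)
(* (1) => (2): the translates of a paradoxical decomposition would have total
   mass at least 2.
   (2) => (3): let K, eps witness the failure of (3), let W_n be the n-th power
   of the union of K and {1}, and let P be the set of conjugates w^-1 g w with w in
   W_n and 1 <> g in K.  If F is finite and avoids Fix(p) for all p in P, then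
   W_i F avoids Fix(g) for 1 <> g in K and i <= n, so the failure of (3) makes
   W_i F grow and |W_n F| >= (1 + n eps / 2) |F| >= 2 |F| for large n.  Hall's
   theorem for infinite families of finite sets then provides two injections
   with disjoint images from the complement of the sets Fix(p), each moving
   points by elements of W_n: this is a paradoxical decomposition.
   (3) => (1): take an ultralimit of the densities |F :&: A| / |F|. *)
Require Import Defs.
From HB Require Import structures.
From mathcomp Require Import all_boot all_order all_algebra finmap.
From mathcomp Require Import boolp classical_sets cardinality reals.
From mathcomp Require Import filter topology normedtype lra.

Set Implicit Arguments.
Unset Strict Implicit.
Unset Printing Implicit Defensive.

Import Order.TTheory GRing.Theory Num.Theory.
Import numFieldNormedType.Exports.

Local Open Scope classical_set_scope.

(** * Hall's marriage theorem for infinite families of finite sets *)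

Section Hall.
Variables (I T : choiceType) (N : I -> {fset T}).

Definition Hall_condition (M : I -> {fset T}) :=
  forall E : {fset I}, (#|` E| <= #|` (\bigcup_(i <- E) M i)%fset|)%N.

(** Deleted edges are recorded rather than remaining ones, so that a minimal graph satisfying Hall's
    condition is a maximal [D], which Zorn's lemma for unions of chains provides. *)
Let kept (D : set (I * T)) (i : I) : {fset T} :=
  [fset x in N i | ~~ `[< D (i, x) >]]%fset.

Let keptP D i x : reflect (x \in N i /\ ~ D (i, x)) (x \in kept D i).
Proof.
rewrite !inE /=; apply: (iffP andP) => -[-> h]; split => //.
  by move/asboolPn: h.
by apply/asboolPn.
Qed.

Let chain_finite (C : set (set (I * T))) (D0 : set (I * T)) (s : seq (I * T)) :
  total_on C subset -> C D0 -> (forall e, e \in s -> (\bigcup_(D in C) D) e) ->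
  exists2 D, C D & forall e, e \in s -> D e.
Proof.
move=> Ctot CD0; elim: s => [|e s IHs] hs; first by exists D0.
have [D CD sD] : exists2 D, C D & forall e, e \in s -> D e.
  by apply: IHs => e' se'; apply: hs; rewrite inE se' orbT.
have [D' CD' De'] : (\bigcup_(D in C) D) e by apply: hs; rewrite inE eqxx.
have [DD'|D'D] := Ctot _ _ CD CD'.
  by exists D' => // e'; rewrite inE => /orP[/eqP -> //|/sD /DD'].
by exists D => // e'; rewrite inE => /orP[/eqP ->|/sD //]; apply: D'D.
Qed.

(** Hall's condition at [E] sees only the finitely many edges leaving [E], and a single member of a
    nonempty chain already deletes all of those that the union deletes. The empty chain deletes
    nothing and is settled by [HN]. *)
Let maximal_removal : Hall_condition N -> exists D,
  Hall_condition (kept D) /\ forall D', D `<` D' -> ~ Hall_condition (kept D').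
Proof.
move=> HN; apply: (@Zorn_bigcup _ (fun D => Hall_condition (kept D))) => C CP Ctot E.
have [[D0 CD0]|C0] := pselect (exists D, C D); last first.
  apply: (leq_trans (HN E)); apply: fsubset_leq_card; apply/fsubsetP => x.
  move=> /bigfcupP[i iE xi]; apply/bigfcupP; exists i => //.
  by apply/keptP; split=> // -[D CD]; case: C0; exists D.
pose s := [seq e <- [seq (i, x) | i <- enum_fset E, x <- enum_fset (N i)]
          | `[< (\bigcup_(D in C) D) e >]].
have [e|D CD sD] := @chain_finite C D0 s Ctot CD0.
  by rewrite mem_filter => /andP[/asboolP].
apply: (leq_trans (CP _ CD E)); apply: fsubset_leq_card; apply/fsubsetP => x.
move=> /bigfcupP[i /[!andbT] iE /keptP[xi Dx]].
apply/bigfcupP; exists i; rewrite ?iE//.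
apply/keptP; split => // Cx; apply: Dx; apply: sD; rewrite mem_filter.
by apply/andP; split; [apply/asboolP|apply/allpairsPdep; exists i, x].
Qed.

(* Rado's argument: if two edges at i could not be removed, submodularity of
   the cardinal of the neighbourhood would contradict Hall's condition. *)
Lemma Hall_injection : Hall_condition N ->
  exists2 f : I -> T, injective f & forall i, f i \in N i.
Proof.
move=> /maximal_removal[D [HD maxD]].
pose nb (E : {fset I}) := (\bigcup_(i <- E) kept D i)%fset.
(* By maximality, deleting the edge [(i, x)] breaks Hall's condition on some finite set. That set
   contains [i], since otherwise its neighbourhood would be unchanged; the witness is this set
   without [i]. *)
have deficient i x : x \in kept D i -> exists2 E : {fset I}, i \notin E &
    (#|` nb E `|` (kept D i `\ x)| <= #|` E|)%fset%N.
  move=> /keptP[xi Dx].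
  have /maxD : D `<` D `|` [set (i, x)].
    by split; [left | move=> /(_ (i, x)) h; apply: Dx; apply: h; right].
  move=> /existsNP[E /negP]; rewrite -ltnNge => ltE.
  have subnb (E' : {fset I}) : (forall j, j \in E' -> j \in E /\ j <> i) ->
      (nb E' `<=` \bigcup_(j <- E) kept (D `|` [set (i, x)]) j)%fset.
    move=> sE; apply/fsubsetP => y /bigfcupP[j /[!andbT] /sE[jE ji] /keptP[yj Dy]].
    apply/bigfcupP; exists j; rewrite ?jE//; apply/keptP; split=> // -[//|].
    by case=> /ji.
  have iE : i \in E.
    apply: contraLR ltE => iE; rewrite -leqNgt (leq_trans (HD E))//.
    by apply: fsubset_leq_card; apply: subnb => j jE; split=> // ji;
       rewrite ji (negPf iE) in jE.
  exists (E `\ i)%fset; first by rewrite !inE eqxx.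
  rewrite -ltnS -[X in (_ < X)%N]add1n.
  have -> : (1 + #|` (E `\ i)%fset| = #|` E|)%N by rewrite [RHS](cardfsD1 i) iE.
  apply: leq_ltn_trans ltE; apply: fsubset_leq_card.
  rewrite fsubUset subnb; last by move=> j; rewrite !inE => /andP[/eqP].
  apply/fsubsetP => y; rewrite in_fsetD1 => /andP[yx /keptP[yi Dy]].
  apply/bigfcupP; exists i; rewrite ?iE//; apply/keptP; split=> // -[//|].
  by case=> /eqP; apply/negP.
have nbS (A B : {fset I}) : (A `<=` B -> nb A `<=` nb B)%fset.
  move=> AB; apply/fsubsetP => y /bigfcupP[j /[!andbT] jA yj].
  by apply/bigfcupP; exists j; rewrite ?(fsubsetP AB).
have kept_unique i x y : x \in kept D i -> y \in kept D i -> x = y.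
  move=> xi yi; apply/eqP/negPn/negP => xy.
  have [E1 iE1 h1] := deficient _ _ xi; have [E2 iE2 h2] := deficient _ _ yi.
  (* As [x] and [y] differ, the union of the two sets bounded in [h1] and [h2] contains all
     neighbours of [i], [E1] and [E2], while their intersection contains those of the indices common
     to [E1] and [E2]. Hall's condition for both then exceeds the bound by one, the contribution of
     [i]. *)
  have := leq_add h1 h2; rewrite -cardfsUI -[X in (_ <= X)%N]cardfsUI leqNgt.
  apply/negP; rewrite negbK.
  have iE12 : i \notin (E1 `|` E2)%fset by rewrite inE negb_or iE1.
  have lt12 : (#|` E1 `|` E2| + #|` E1 `&` E2| <
     #|` i |` (E1 `|` E2)| + #|` E1 `&` E2|)%fset%N.
    by rewrite ltn_add2r cardfsU1 iE12 add1n.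
  apply: (leq_trans lt12); apply: leq_add.
    apply: (leq_trans (HD _)); apply: fsubset_leq_card; apply/fsubsetP => z.
    move=> /bigfcupP[k /[!andbT] kE zk]; rewrite !in_fsetU !in_fsetD1.
    move: kE; rewrite in_fset1U in_fsetU => /or3P[/eqP ki|kE|kE].
    - rewrite ki in zk.
      by have [zx|zx] := eqVneq z x; rewrite zk ?zx ?xy /= ?andbT ?orbT.
    - suff -> : z \in nb E1 by [].
      by apply/bigfcupP; exists k; rewrite ?kE.
    - suff -> : z \in nb E2 by rewrite !orbT.
      by apply/bigfcupP; exists k; rewrite ?kE.
  apply: (leq_trans (HD _)); apply: fsubset_leq_card; rewrite fsubsetI.
  by rewrite !fsubsetU ?nbS ?fsubsetIl ?fsubsetIr.
have nonempty i : exists x, x \in kept D i.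
  have := HD [fset i]%fset; rewrite cardfs1 cardfs_gt0 => /fset0Pn[x].
  by move=> /bigfcupP[j /[!andbT]]; rewrite inE => /eqP ->; exists x.
have [f fP] := choice nonempty.
exists f; last by move=> i; have /keptP[] := fP i.
(* Each index has a single remaining neighbour, so a collision would leave two indices with one
   neighbour between them. *)
move=> i j fij; apply/eqP/negPn/negP => ij.
have := HD [fset i; j]%fset; rewrite cardfs2 ij leqNgt => /negP; apply.
rewrite ltnS /= -(cardfs1 (f i)).
apply: fsubset_leq_card; apply/fsubsetP => y /bigfcupP[k /[!andbT]].
rewrite in_fset2 in_fset1 => /orP[] /eqP -> yk; apply/eqP.
  exact: kept_unique yk (fP i).
by rewrite fij; exact: kept_unique yk (fP j).
Qed.

End Hall.

Local Open Scope ring_scope.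

(** * Group actions: translates of finite sets and their cardinals *)

Section Action.
Variables (R : realType) (G : groupType) (X : choiceType) (a : left_action G X).

Lemma actK g : cancel (a g) (a g^-1%g).
Proof. by move=> x; rewrite -act_mul mulVg act_one. Qed.

Lemma act_inj g : injective (a g).
Proof. exact: can_inj (actK g). Qed.

(** Reduces the absence of fixed points on a translate of [F] to a condition on [F] itself, at the
    price of conjugating [g]. *)
Lemma Fix_conj g w x : Fix a g (a w x) -> Fix a (w^-1 * g * w)%g x.
Proof. by rewrite /Fix /= !act_mul => ->; rewrite actK. Qed.

Lemma conj_neq1 (g w : G) : g <> 1%g -> (w^-1 * g * w)%g <> 1%g.
Proof.
move=> g1 h; apply: g1; have : (w * (w^-1 * g * w) * w^-1)%g = 1%g.
  by rewrite h mulg1 mulgV.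
by rewrite !mulgA mulgV mul1g -mulgA mulgV mulg1.
Qed.

Definition set_act (S : {fset G}) (F : {fset X}) : {fset X} :=
  [fset a s x | s in S, x in F]%fset.

Lemma set_actP S F y :
  reflect (exists s x, [/\ s \in S, x \in F & y = a s x]) (y \in set_act S F).
Proof.
apply: (iffP (imfset2P _ _ _ _ _)) => /=.
  by move=> [s sS [x xF ->]]; exists s, x.
by move=> [s [x [sS xF ->]]]; exists s => //; exists x.
Qed.

Lemma set_actM S T F : set_act [fset (s * t)%g | s in S, t in T]%fset F =
  set_act S (set_act T F).
Proof.
apply/fsetP => y; apply/set_actP/set_actP.
  move=> [_ [x [/imfset2P[s /= sS [t tT ->]] xF ->]]].
  by exists s, (a t x); split; rewrite ?act_mul//; apply/set_actP; exists t, x.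
move=> [s [_ [sS /set_actP[t [x [tT xF ->]]] ->]]].
exists (s * t)%g, x; split; rewrite ?act_mul//.
by apply/imfset2P; exists s => //; exists t.
Qed.

Lemma set_act1 F : set_act [fset 1%g]%fset F = F.
Proof.
apply/fsetP => y; apply/set_actP/idP.
  by move=> [s [x [/[!inE] /eqP -> xF ->]]]; rewrite act_one.
by exists 1%g, y; rewrite inE act_one.
Qed.

Lemma translate_fsetE g (F : {fset X}) :
  a g @` [set` F] = [set` (a g @` F)%fset].
Proof.
apply/seteqP; split=> [_ [x xF <-]|y /imfsetP[x /= xF ->]]; last by exists x.
exact: in_imfset.
Qed.

(** A set and its translate have the same cardinal, so the two halves of their symmetric difference
    do too. *)
Lemma card_translate_symdiff g (F : {fset X}) :
  #|` fset_set ((a g @` [set` F]) `+` [set` F])| =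
    (#|` (a g @` F) `\` F| * 2)%fset%N.
Proof.
rewrite translate_fsetE /setY fset_setU; try exact: finite_setD.
rewrite !fset_setD ?set_fsetK; try exact: finite_fset.
rewrite cardfsU (_ : (_ `&` _)%fset = fset0); last first.
  by apply/fsetP => x; rewrite !inE; case: (x \in F); rewrite ?andbF.
rewrite cardfs0 subn0 muln2 -addnn; congr addn; rewrite !cardfsD.
by rewrite fsetIC (card_imfset _ _ (@act_inj g)).
Qed.

Lemma card_Fix_fset g (F : {fset X}) :
  #|` fset_set (Fix a g `&` [set` F])| = #|` [fset x in F | `[< Fix a g x >]]%fset|.
Proof.
congr (#|` _|); apply/fsetP => x.
rewrite in_fset_set; last by apply: finite_setIr; exact: finite_fset.
rewrite !inE /=.
apply/idP/andP; rewrite in_setE => -[]; first by split=> //; apply/asboolP.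
by move=> xF /asboolP.
Qed.

(** * From non-paradoxical actions to almost invariant, almost free finite sets *)

Lemma doubling_paradoxical (P S : {fset G}) :
  (forall p, p \in P -> p <> 1%g) ->
  (forall F : {fset X}, (forall x p, x \in F -> p \in P -> ~ Fix a p x) ->
    (2 * #|` F| <= #|` set_act S F|)%N) ->
  paradoxical a.
Proof.
move=> P1 dbl.
pose Y := [set x | forall p, p \in P -> ~ Fix a p x].
(* The Boolean duplicates every point of [Y], and [N] ignores it: an injective choice is a pair of
   injections of [Y] with disjoint images. *)
pose I : choiceType := ({x : X | `[< Y x >]} * bool)%type.
pose N (i : I) := set_act S [fset val i.1]%fset.
have HN : Hall_condition N.
  move=> E; pose F := [fset val i.1 | i in E]%fset.
  have -> : (\bigcup_(i <- E) N i)%fset = set_act S F.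
    apply/fsetP => y; apply/bigfcupP/set_actP.
      move=> [i /[!andbT] iE /set_actP[s [x [sS]]]]; rewrite inE => /eqP -> ->.
      by exists s, (val i.1); split=> //; apply/imfsetP; exists i.
    move=> [s [_ [sS /imfsetP[i /= iE ->] ->]]]; exists i; rewrite ?iE//.
    by apply/set_actP; exists s, (val i.1); rewrite inE.
  apply: leq_trans (dbl F _); last first.
    by move=> x p /imfsetP[[[u /= Yu] b] /= _ ->]; move/asboolP: Yu => /[apply].
  (* [E] lies in two copies of its projection [U], which accounts for the factor 2 in [dbl]. *)
  pose U := [fset i.1 | i in E]%fset.
  have sub : (E `<=` [fset ((u, true) : I) | u in U] `|`
                     [fset ((u, false) : I) | u in U])%fset.
    apply/fsubsetP => -[u b] iE; rewrite in_fsetU.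
    have uU : u \in U by apply/imfsetP; exists (u, b).
    by apply/orP; case: b {iE}; [left|right]; apply/imfsetP; exists u.
  have -> : #|` F| = #|` U|.
    transitivity #|` [fset val u | u in U]%fset|; last first.
      exact: (card_imfset _ _ val_inj).
    congr (#|` _|).
    apply/fsetP => y; apply/imfsetP/imfsetP => /=.
      by move=> [i iE ->]; exists i.1 => //; apply/imfsetP; exists i.
    by move=> [_ /imfsetP[i /= iE ->] ->]; exists i.
  apply: (leq_trans (fsubset_leq_card sub)); apply: (leq_trans (leq_card_fsetU _ _)).
  by rewrite mul2n -addnn leq_add// leq_imfset_card.
have [f finj fN] := Hall_injection HN.
have /choice[c cP] (i : I) : exists s, s \in S /\ f i = a s (val i.1).
  have /set_actP[s [x [sS]]] := fN i.
  by rewrite inE => /eqP -> ->; exists s.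
pose J : finType := (S * S)%type.
(* Pieces are indexed by pairs of elements of [S]: on each piece both injections act by constant
   group elements. Some pieces may be empty. *)
pose A (k : 'I_#|J|) := [set x | exists2 u : {x : X | `[< Y x >]}, val u = x &
  c (u, false) = val (enum_val k).1 /\ c (u, true) = val (enum_val k).2].
pose JP : finType := fset_sub_type P.
exists #|J|, #|JP|, A, (fun j => Fix a (val (enum_val j : JP))); split.
- apply/esym/seteqP; split=> // x _.
  have [Yx|] := pselect (Y x).
    left; move/asboolP: (Yx) => bYx; pose u : {x : X | `[< Y x >]} := exist _ x bYx.
    pose e : J := ([` (cP (u, false)).1], [` (cP (u, true)).1])%fset.
    exists (enum_rank e) => //; exists u => //.
    by rewrite enum_rankK.
  move=> /existsNP[p /not_implyP[pP /contrapT px]]; right.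
  by exists (enum_rank [` pP]%fset) => //; rewrite enum_rankK.
- exists (fun k => val (enum_val k).1), (fun k => val (enum_val k).2).
  pose q (k : 'I_#|J| + 'I_#|J|) := if k is inl _ then false else true.
  pose t (k : 'I_#|J| + 'I_#|J|) := match k with inl i | inr i => i end.
  have im k z : (match k with
                 | inl i => a (val (enum_val i).1) @` A i
                 | inr i => a (val (enum_val i).2) @` A i
                 end) z -> exists2 u, z = f (u, q k) &
      c (u, false) = val (enum_val (t k)).1 /\ c (u, true) = val (enum_val (t k)).2.
    case: k => k [_ [u <- [c1 c2]] <-]; exists u => //=.
      by rewrite (cP (u, false)).2 c1.
    by rewrite (cP (u, true)).2 c2.
  (* A point common to two translates is a value of [f]; injectivity recovers its source, whose
     Boolean gives the side of the sum and whose movers give the piece. *)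
  move=> i j _ _ [z [/im[u -> [ui1 ui2]] /im[v /finj[<- qij] [vj1 vj2]]]].
  have : t i = t j.
    apply/enum_val_inj; rewrite [LHS]surjective_pairing [RHS]surjective_pairing.
    by congr pair; apply: val_inj; rewrite -?ui1 -?ui2.
  by case: i j qij {ui1 ui2 vj1 vj2} => i [] j //= _ ->.
- by move=> j; exists (val (enum_val j)) => //; apply: P1; exact: valP.
Qed.

Lemma nonparadoxical_Folner : ~ paradoxical a -> free_Folner R a.
Proof.
move=> npar; apply: contrapT => nF; apply: npar.
(* On a set without fixed points of the nontrivial elements of [K], the density in (b) is 0, so the
   failure of (3) must come from (a). *)
have {nF} [K [eps [eps0 nF]]] : exists K : {fset G}, exists eps : R, 0 < eps /\
  forall F : {fset X}, F != fset0 ->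
    (forall g, g \in K -> g <> 1%g -> forall x, x \in F -> ~ Fix a g x) ->
    exists2 g, g \in K & eps * #|` F|%:R <= (#|` (a g @` F) `\` F| * 2)%fset%N%:R.
  move: nF => /existsNP[K /existsNP[eps /not_implyP[eps0 nF]]].
  exists K, eps; split=> // F F0 free; apply: contrapT => small; apply: nF.
  have F0' : 0 < #|` F|%:R :> R by rewrite ltr0n cardfs_gt0.
  exists F; split=> // g gK.
    rewrite card_translate_symdiff ltr_pdivrMr// ltNge; apply/negP => ?.
    by apply: small; exists g.
  move=> g1; rewrite card_Fix_fset (_ : [fset _ | _ in _ & _]%fset = fset0).
    by rewrite cardfs0 mul0r.
  apply/fsetP => x; rewrite !inE; apply/negbTE/andP => -[xF /asboolP].
  exact: free.
(* Adjoining 1 makes the sets [W n] increasing, so that [P N] controls the fixed points at all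
   stages up to [N]. *)
pose K1 := (1%g |` K)%fset.
pose W n := iter n (fun V => [fset (s * t)%g | s in K1, t in V]%fset)
  [fset 1%g]%fset.
pose P n := [fset (w^-1 * g * w)%g |
    w in W n, g in [fset g in K | g != 1%g]%fset]%fset.
have WS n : set_act (W n.+1) =1 set_act K1 \o set_act (W n).
  by move=> F; rewrite /= set_actM.
have subW m n : (m <= n)%N -> (W m `<=` W n)%fset.
  elim: n => [|n IHn]; first by rewrite leqn0 => /eqP ->.
  rewrite leq_eqVlt => /predU1P[-> //|/IHn] /fsubset_trans; apply.
  apply/fsubsetP => w wW; apply/imfset2P; exists 1%g; first by rewrite !inE eqxx.
  by exists w => //; rewrite mul1g.
have growth N (F : {fset X}) n : (n <= N)%N ->
    (forall x p, x \in F -> p \in P N -> ~ Fix a p x) ->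
    (1 + n%:R * (eps / 2)) * #|` F|%:R <= #|` set_act (W n) F|%:R :> R.
  move=> + free; elim: n => [_|n IHn nN]; first
    by rewrite mul0r addr0 mul1r set_act1.
  have [->|F0] := eqVneq F fset0; first by rewrite cardfs0 mulr0.
  have {}IHn := IHn (ltnW nN).
  set F' := set_act (W n) F in IHn.
  have leF : #|` F|%:R <= #|` F'|%:R :> R.
    apply: le_trans IHn; rewrite ler_peMl// lerDl mulr_ge0// ltW// divr_gt0//.
  have F'0 : F' != fset0.
    by rewrite -cardfs_gt0 -(ltr0n R) (lt_le_trans _ leF)// ltr0n cardfs_gt0.
  have [|g gK gF'] := nF F' F'0.
    move=> g gK g1 _ /set_actP[w [x [wW xF ->]]] /Fix_conj; apply: free => //.
    apply/imfset2P; exists w; first by rewrite (fsubsetP (subW _ _ (ltnW nN))).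
    by exists g => //; rewrite !inE gK; apply/eqP.
  have sub : ((a g @` F') `\` F' `|` F' `<=` set_act K1 F')%fset.
    apply/fsubsetP => x; rewrite in_fsetU => /orP[|xF'].
      rewrite in_fsetD => /andP[_ /imfsetP[y /= yF' ->]].
      by apply/set_actP; exists g, y; rewrite !inE gK orbT.
    by apply/set_actP; exists 1%g, x; rewrite !inE eqxx act_one.
  rewrite WS /=; have := fsubset_leq_card sub.
  rewrite cardfsU (_ : (_ `&` _)%fset = fset0); last first.
    by apply/fsetP => x; rewrite !inE; case: (x \in F'); rewrite ?andbF.
  rewrite cardfs0 subn0 -(ler_nat R) natrD; apply: le_trans.
  (* Half of the symmetric difference is new, and [leF] bounds it below in terms of the initial [F]:
     the growth obtained is linear in [n]. *)
  move: gF'; rewrite natrM => gF'; have := ler_wpM2l (ltW eps0) leF.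
  rewrite -[n.+1]addn1 natrD; move: IHn; lra.
have [N hN] : exists N, 1 <= N%:R * (eps / 2).
  exists (Num.truncn (2 / eps)).+1.
  have /ltW := truncnS_gt (2 / eps).
  by rewrite ler_pdivrMr// mulrA ler_pdivlMr// mul1r.
apply: (@doubling_paradoxical (P N) (W N)).
  by move=> _ /imfset2P[w /= _ [g /[!inE] /andP[_ /eqP g1] ->]]; exact: conj_neq1.
move=> F free; rewrite -(ler_nat R); apply: le_trans (growth N F N (leqnn N) free).
by rewrite natrM ler_wpM2r// -[2%:R]/(1 + 1) lerD2l.
Qed.

(** * Invariant measures as ultralimits of densities *)

Lemma ultrafilter_cvg01 (T : Type) (U : set_system T) (f : T -> R) :
  UltraFilter U -> (forall t, 0 <= f t <= 1) -> exists l : R, f @ U --> l.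
Proof.
move=> UU f01; have PU : ProperFilter U by exact: ultra_proper.
have fU : (f @ U) `[0, 1]%classic.
  by apply: (@filterE _ U) => t; rewrite /= in_itv; exact: f01.
have [l [_ clu]] := @segment_compact R 0 1 (f @ U) _ fU.
(* An ultrafilter converges to each of its cluster points: otherwise it would contain the complement
   of a neighbourhood. *)
exists l => V lV; have [//|UVC] := in_ultra_setVsetC (f @^-1` V) UU.
have [z [Vz]] := clu (~` V) V UVC lV.
by [].
Qed.

(** Translation by [g] sends the part of [A] in [F] into the translate of [A], and the image leaves
    [F] only through the boundary term. *)
Lemma card_translate_le g (A : set X) (F : {fset X}) :
  (#|` [fset x in F | `[< A x >]]| <=
   #|` [fset x in F | `[< (a g @` A)%classic x >]]| + #|` (a g @` F) `\` F|)%fset%N.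
Proof.
have <- : #|` a g @` [fset x in F | `[< A x >]]|%fset =
    #|` [fset x in F | `[< A x >]]|%fset.
  by exact: (card_imfset _ _ (@act_inj g)).
apply: leq_trans (leq_card_fsetU _ _).
apply: fsubset_leq_card; apply/fsubsetP => y /imfsetP[x /=].
rewrite !inE => /andP[xF /asboolP Ax] ->.
rewrite in_imfset//= andbT; case: (a g x \in F) => //=; rewrite orbF.
by apply/asboolP; exists x.
Qed.

Lemma Folner_amenable : free_Folner R a -> essentially_free_amenable R a.
Proof.
(* An index [(K, n)] stands for the requirement (3) with the finite set [K] and tolerance
   [1/(n+1)]. *)
move=> Fol; pose T : Type := ({fset G} * nat)%type.
have /choice[F FP] (t : T) : exists F : {fset X}, [/\ F != fset0,
    forall g, g \in t.1 ->
      (#|` (a g @` F) `\` F| * 2)%fset%N%:R / #|` F|%:R < t.2.+1%:R^-1 :> R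
  & forall g, g \in t.1 -> g <> 1%g ->
    #|` [fset x in F | `[< Fix a g x >]]%fset|%:R / #|` F|%:R < t.2.+1%:R^-1 :> R].
  have [|F [F0 F1 F2]] := Fol t.1 t.2.+1%:R^-1; first by rewrite invr_gt0 ltr0n.
  exists F; split=> // g; first by rewrite -card_translate_symdiff; exact: F1.
  by rewrite -card_Fix_fset; exact: F2.
(* The tails of the directed order on requirements; an ultrafilter refining them makes every finite
   [K] and every tolerance eventually satisfied. *)
pose tail (t : T) : set T := [set t' | (t.1 `<=` t'.1)%fset /\ (t.2 <= t'.2)%N].
pose B : set_system T := filter_from setT tail.
have BF : ProperFilter B.
  apply: filter_from_proper; last by move=> t _; exists t; split => //=.
  apply: filter_from_filter; first by exists (fset0, 0%N).
  move=> [K m] [L n] _ _; exists (K `|` L, maxn m n)%fset => //.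
  move=> [K' n'] [/=]; rewrite fsubUset geq_max => /andP[KK' LK'] /andP[mn' nn'].
  by split; split.
have [U [UU BU]] := ultraFilterLemma BF.
have PU : ProperFilter U by exact: ultra_proper.
pose dens (A : set X) (t : T) : R :=
  #|` [fset x in F t | `[< A x >]]%fset|%:R / #|` F t|%:R.
have F0 t : 0 < #|` F t|%:R :> R by have [? _ _] := FP t; rewrite ltr0n cardfs_gt0.
have dens01 A t : 0 <= dens A t <= 1.
  rewrite /dens divr_ge0//= ler_pdivrMr// mul1r ler_nat; apply: fsubset_leq_card.
  by apply/fsubsetP => x; rewrite !inE => /andP[].
have /choice[mu muP] (A : set X) : exists l : R, dens A @ U --> l.
  exact: ultrafilter_cvg01 UU (dens01 A).
have muE A l : dens A @ U --> l -> mu A = l.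
  by move=> h; apply: cvg_unique (muP A) h.
have small (u : T -> R) (K : {fset G}) :
    (forall t, (K `<=` t.1)%fset -> `|u t| <= t.2.+1%:R^-1) -> u @ U --> (0 : R).
  move=> hu; apply/cvgrPdist_le => /= e e0; apply: BU.
  exists (K, Num.truncn e^-1) => // -[K' n] [/= KK' ln].
  rewrite sub0r normrN; apply: (le_trans (hu (K', n) KK')) => /=.
  rewrite -[leRHS]invrK lef_pV2 ?posrE ?invr_gt0//.
  by apply: (le_trans (ltW (truncnS_gt _))); rewrite ler_nat.
exists mu; split.
- split => [A|A B' AB|].
  + apply: (cvgr_to_ge (muP A)); apply: nearW => t; by case/andP: (dens01 A t).
  + apply: muE; rewrite (_ : dens _ = dens A \+ dens B'); first exact: cvgD.
    apply/funext => t; rewrite /dens /= -mulrDl -natrD; congr (_%:R / _).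
    rewrite -cardfsUI (_ : (_ `&` _)%fset = fset0) ?cardfs0 ?addn0.
      congr (#|` _|); apply/fsetP => x; rewrite !inE /= -andb_orr; congr (_ && _).
      by rewrite asbool_or.
    apply/fsetP => x; rewrite !inE /=; apply/negbTE/negP.
    move=> /andP[/andP[_ /asboolP Ax] /andP[_ /asboolP Bx]].
    by rewrite -[False]/(set0 x) -AB.
  + apply: muE; rewrite (_ : dens _ = (fun=> 1)); first exact: cvg_cst.
    apply/funext => t; rewrite /dens (_ : [fset _ | _ in _ & _]%fset = F t).
      by rewrite divff// gt_eqF.
    by apply/fsetP => x; rewrite !inE /= asboolT ?andbT.
- move=> g A; apply: muE.
  rewrite (_ : dens _ = dens A \+ (dens (a g @` A) \- dens A)); last first.
    by apply/funext => t /=; rewrite addrC subrK.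
  rewrite -[mu A]addr0; apply: cvgD => //.
  apply: (@small _ [fset g; g^-1%g]%fset) => t /fsubsetP sK.
  (* This one-sided estimate serves twice, for [g] from [A] to its translate and for the inverse of
     [g] on the way back; hence both elements are put in the finite set. *)
  have step g' B1 B2 : g' \in t.1 -> a g' @` B1 = B2 ->
      dens B1 t <= dens B2 t + t.2.+1%:R^-1.
    move=> g't <-; have [_ /(_ g' g't)/ltW ltF _] := FP t.
    apply: le_trans (lerD (lexx _) ltF); rewrite /dens -mulrDl -natrD.
    rewrite ler_pM2r ?invr_gt0// ler_nat.
    by apply: (leq_trans (card_translate_le g' B1 (F t)));
       rewrite ?leq_add2l ?leq_pmulr.
  rewrite /= ler_distl lerBlDr; apply/andP; split.
    by apply: (step g) => //; apply: sK; rewrite !inE eqxx.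
  apply: (step g^-1%g); first by apply: sK; rewrite !inE eqxx orbT.
  rewrite image_comp (_ : _ \o _ = id) ?image_id//.
  by apply/funext => x /=; rewrite actK.
- move=> g g1; apply: muE; apply: (@small _ [fset g]%fset) => t /fsubsetP sK.
  have [_ _ /(_ g)] := FP t; rewrite ger0_norm ?(andP (dens01 _ _)).1// => h.
  by apply/ltW/h => //; apply: sK; rewrite inE.
Qed.

(** * Finitely additive measures exclude paradoxical decompositions *)

Lemma fap_le (mu : set X -> R) (A B : set X) :
  finitely_additive_probability mu -> A `<=` B -> mu A <= mu B.
Proof.
move=> [ge0 add _] AB; rewrite -(setDUK AB) add ?lerDl//.
by rewrite setDE setICA setICr setI0.
Qed.

Lemma fap_set0 (mu : set X -> R) : finitely_additive_probability mu -> mu set0 = 0.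
Proof.
move=> [ge0 add _]; have := add set0 set0 (setI0 _); rewrite setU0 => h.
by apply: (addrI (mu set0)); rewrite addr0.
Qed.

Lemma fap_leU (mu : set X -> R) (A B : set X) :
  finitely_additive_probability mu -> mu (A `|` B) <= mu A + mu B.
Proof.
move=> fap; have [ge0 add _] := fap.
have -> : A `|` B = A `|` (B `\` A) by rewrite setUDr setDv setD0.
rewrite add ?lerD2l ?fap_le//; last by rewrite setDE setICA setICr setI0.
Qed.

Lemma fap_le_bigcup (mu : set X -> R) n (A : 'I_n -> set X) :
  finitely_additive_probability mu -> mu (\bigcup_i A i) <= \sum_i mu (A i).
Proof.
move=> fap; elim: n A => [|n IHn] A.
  by rewrite big_ord0 (_ : \bigcup_i A i = set0) ?fap_set0// -subset0 => x [[]].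
rewrite big_ord_recl; apply: le_trans (lerD (lexx _) (IHn _)).
apply: le_trans (fap_leU _ _ fap); apply: fap_le => // x [i _ Ax].
case: (unliftP ord0 i) => [j|] ij; rewrite ij in Ax; last by left.
by right; exists j.
Qed.

Lemma fap_bigcup (mu : set X -> R) n (A : 'I_n -> set X) :
  finitely_additive_probability mu -> trivIset setT A ->
  mu (\bigcup_i A i) = \sum_i mu (A i).
Proof.
move=> fap; elim: n A => [|n IHn] A tA.
  by rewrite big_ord0 (_ : \bigcup_i A i = set0) ?fap_set0// -subset0 => x [[]].
rewrite big_ord_recl -IHn; last first.
  by move=> i j _ _ /(tA _ _ Logic.I Logic.I) /lift_inj.
rewrite -fap_additive//; last first.
  rewrite -subset0 => x [A0 [j _ Aj]].
  by have : ord0 = lift ord0 j by apply: tA => //; exists x.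
congr mu; apply/seteqP; split=> x.
  move=> [i _ Ax]; case: (unliftP ord0 i) => [j|] ij; rewrite ij in Ax; last by left.
  by right; exists j.
by move=> [A0|[j _ Aj]]; [exists ord0|exists (lift ord0 j)].
Qed.

Lemma amenable_nonparadoxical : essentially_free_amenable R a -> ~ paradoxical a.
Proof.
move=> [mu [fap inv free]] [l [m [A [B [cov [g [h tr]] BP]]]]].
have B0 j : mu (B j) = 0 by have [p p1 ->] := BP j; exact: free.
(* The fixed point sets are null, so the pieces [A i] alone must carry the whole mass. *)
have le1 : 1 <= \sum_i mu (A i).
  rewrite -(fap_total fap) cov; apply: le_trans (fap_leU _ _ fap) _.
  have B_null : mu (\bigcup_i B i) <= 0.
    by apply: le_trans (fap_le_bigcup B fap) _; rewrite big1.
  by rewrite (le_trans (lerD (fap_le_bigcup A fap) B_null))// addr0.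
have tg : trivIset setT (fun i => a (g i) @` A i).
  by move=> i j _ _ ij; have /(_ ij)[] := tr (inl i) (inl j) Logic.I Logic.I.
have th : trivIset setT (fun i => a (h i) @` A i).
  by move=> i j _ _ ij; have /(_ ij)[] := tr (inr i) (inr j) Logic.I Logic.I.
have : mu ((\bigcup_i (a (g i) @` A i)) `|` (\bigcup_i (a (h i) @` A i))) <= 1.
  by rewrite -(fap_total fap) fap_le.
rewrite fap_additive//; last first.
  (* A common point would equate an index on the left of the sum type with one on the right. *)
  rewrite -subset0 => x [[i _ xi] [j _ xj]].
  have : inl i = inr j by apply: tr => //; exists x.
  by [].
have sum_translates (e : 'I_l -> G) : \sum_i mu (a (e i) @` A i) = \sum_i mu (A i).
  by apply: eq_bigr => i _; exact: inv.
by rewrite !fap_bigcup// !sum_translates; move: le1; lra.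
Qed.

End Action.

Theorem theorem3 (R : realType) (G : groupType) (X : choiceType)
    (a : left_action G X) :
  (essentially_free_amenable R a <-> ~ paradoxical a) /\
  (~ paradoxical a <-> free_Folner R a).
Proof.
have amen_np := @amenable_nonparadoxical R G X a.
have np_Fol := @nonparadoxical_Folner R G X a.
have Fol_amen := @Folner_amenable R G X a.
split; split=> //; first by move=> /np_Fol /Fol_amen.
by move=> /Fol_amen /amen_np.
Qed.
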